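(* Let $S_5(h)$ denote the polynomial with rational coefficients that agrees with $|\mathcal{S}_5(h)|$ for all integers $h\geq 0$. Then, as an identity of polynomials in $c$, $$S_5(c-5/2)=c\binom{c+3/2}{4}\,\frac{16c^4+64c^2-17}{2520}.$$ Equivalently, $$S_5(c-5/2)=c\binom{c+3/2}{4}\binom{c+1/2}{2}\,\frac{4c^2+17}{315}.$$
   Context: For an integer $h\geq0$, $\mathcal{S}_5(h)$ is the set of integer matrices $\pi=(\pi_{ij})_{1\leq i,j\leq5}$ with $0\leq\pi_{ij}\leq 2h$, weakly decreasing along rows and columns ($\pi_{ij}\geq\pi_{i+1,j}$ and $\pi_{ij}\geq\pi_{i,j+1}$ whenever the indices lie in $\{1,\ldots,5\}$), with $\pi_{ij}+\pi_{6-j,6-i}=2h$ whenever $i\neq j$, and with $\pi_{ij}=\pi_{ji}$ for all $i,j$. The function $h\mapsto|\mathcal{S}_5(h)|$ on nonnegative integers is given by a (unique) polynomial in $\mathbb{Q}[h]$. Binomials are polynomials: $\binom{x}{k}=\frac{x(x-1)\cdots(x-k+1)}{k!}$. *)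

(* Defs.v *)
From mathcomp Require Import all_boot all_order all_algebra.

Set Implicit Arguments.
Unset Strict Implicit.
Unset Printing Implicit Defensive.

Import GRing.Theory.
Local Open Scope ring_scope.

(* Rows and columns are indexed from 0, so that the 1-based index 6 - j is    *)
(* [rev_ord j]; the bounds 0 <= pi_ij <= 2h are carried by the entry type.    *)
Definition S5 (h : nat) : {set 'M['I_(2 * h).+1]_5} :=
  [set p : 'M['I_(2 * h).+1]_5 | [&&
    [forall i : 'I_5, forall i' : 'I_5, forall j : 'I_5,
       (i' == i.+1 :> nat) ==> (p i' j <= p i j)%N],
    [forall i : 'I_5, forall j : 'I_5, forall j' : 'I_5,
       (j' == j.+1 :> nat) ==> (p i j' <= p i j)%N],
    [forall i : 'I_5, forall j : 'I_5,
       (i != j) ==> (p i j + p (rev_ord j) (rev_ord i) == 2 * h)%N]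
    & [forall i : 'I_5, forall j : 'I_5, p i j == p j i]]].

Definition counts_S5 (S : {poly rat}) : Prop :=
  forall h : nat, S.[h%:R] = #|S5 h|%:R.

Definition pbinom (x : {poly rat}) (k : nat) : {poly rat} :=
  (k`!%:R)^-1 *: \prod_(i < k) (x - i%:R%:P).

(* Main.v *)
Require Import Defs.
From mathcomp Require Import all_boot all_order all_algebra.
From mathcomp Require Import zify ring.

Set Implicit Arguments.
Unset Strict Implicit.
Unset Printing Implicit Defensive.

Import GRing.Theory.
Local Open Scope ring_scope.

(** The symmetries leave very few free entries in a matrix of [S5 h].  Entries
    off the diagonal that lie on the antidiagonal are their own partners, hence
    equal to [h]; the remaining off-diagonal entries are determined by
    [p 0 1 = h + a], [p 0 2 = h + b], [p 1 2 = h + d] and [p 0 3 = h + c], their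
    partners being [h - a], [h - b], [h - d], [h - c].  The diagonal entries are
    tied to nothing but their neighbours.  Thus the matrix is
<<
           x0    h+a   h+b   h+c   h
           h+a   x1    h+d   h     h-c
           h+b   h+d   x2    h-d   h-b
           h+c   h     h-d   x3    h-a
           h     h-c   h-b   h-a   x4
>>
    and monotonicity amounts to [c, d <= b <= a <= h] together with one interval
    for each [x_i], independently of the others.  The five intervals have
    [h+1-a], [a+1-d], [2d+1], [a+1-d], [h+1-a] elements, and [c] ranges over
    [b + 1] values that enter nowhere else, so
<<
      |S5 h| = sum_(d <= b <= a <= h) (h+1-a)^2 (b+1) (a+1-d)^2 (2d+1)
>>
    ([S5_imset], [card_S5]).  Summing successively over [d], [b] and [a] turns
    this into a polynomial in [h], each step being certified by a closed form
    whose difference is the summand ([sum_dE], [sum_bE], [sum_aE]).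

    Two polynomials that agree at all natural numbers are equal
    ([poly_eq_nat]).  This gives uniqueness of the counting polynomial, and
    reduces the identities to the evaluation of both sides at [c = h + 5/2]. *)

(** * Polynomials determined by their values at natural numbers *)

Lemma poly_eq_nat (R : numDomainType) (p q : {poly R}) :
  (forall n : nat, p.[n%:R] = q.[n%:R]) -> p = q.
Proof.
move=> eq_pq; apply/eqP; rewrite -subr_eq0; apply: contraT => nz.
have /max_poly_roots : p - q != 0 by [].
move=> /(_ [seq n%:R | n <- iota 0 (size (p - q))]).
rewrite size_map size_iota ltnn => -> //.
  by apply/allP => _ /mapP[n _ ->]; rewrite rootE !hornerE eq_pq subrr.
by rewrite map_inj_uniq ?iota_uniq // => m n /eqP; rewrite Num.Theory.eqr_nat => /eqP.
Qed.

(** * Cardinals of fibred sets and of intervals *)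

Lemma card_dep_set (I J : finType) (P : pred I) (box : I -> {set J}) :
  #|[set t : I * J | P t.1 && (t.2 \in box t.1)]|
  = (\sum_(i | P i) #|box i|)%N.
Proof.
rewrite -sum1_card; under [RHS]eq_bigr do rewrite -sum1_card.
by rewrite pair_big_dep /=; apply: eq_bigl => t; rewrite inE.
Qed.

Definition ord_itv n (u v : nat) : {set 'I_n} := [set i : 'I_n | (u <= i <= v)%N].

Lemma card_ord_itv n u v : (v < n)%N -> #|ord_itv n u v| = (v.+1 - u)%N.
Proof.
move=> lt_vn; rewrite -[RHS](size_iota u) cardE -(size_map val).
apply/eqP; rewrite -uniq_size_uniq ?iota_uniq //.
  by rewrite map_inj_uniq ?enum_uniq //; exact: val_inj.
move=> k; rewrite mem_iota; apply/idP/mapP => [/andP[le_uk lt_k]|[i]].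
  have lt_kn : (k < n)%N by lia.
  by exists (Ordinal lt_kn) => //; rewrite mem_enum inE le_uk /=; lia.
by rewrite mem_enum inE => /andP[? ?] -> /=; lia.
Qed.

(** * Parametrisation of the symmetric arrays *)

Section Parametrisation.
Variable h : nat.

Notation offset := 'I_h.+1.
Notation entry := 'I_(2 * h).+1.
Notation offsets := (offset * offset * offset * offset)%type.
Notation diagonal := (entry * entry * entry * entry * entry)%type.

Definition up (k : offset) : entry := inord (h + k).
Definition down (k : offset) : entry := inord (h - k).

Lemma upE k : up k = (h + k)%N :> nat.
Proof. by rewrite inordK //; have := ltn_ord k; lia. Qed.

Lemma downE k : down k = (h - k)%N :> nat.
Proof. by rewrite inordK //; lia. Qed.

Definition array (t : offsets * diagonal) : 'M[entry]_5 :=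
  let: (a, b, d, c, (x0, x1, x2, x3, x4)) := t in
  let m := up ord0 in
  let rows :=
    [:: [:: x0;   up a;   up b;   up c;   m];
        [:: up a; x1;     up d;   m;      down c];
        [:: up b; up d;   x2;     down d; down b];
        [:: up c; m;      down d; x3;     down a];
        [:: m;    down c; down b; down a; x4]] in
  \matrix_(i, j) nth m (nth [::] rows i) j.

(** The inequality [a <= h] is carried by the type of offsets. *)
Definition offsets_ok (q : offsets) : bool :=
  let: (a, b, d, c) := q in [&& b <= a, d <= b & c <= b]%N.

Definition diag_box (q : offsets) : {set diagonal} :=
  let: (a, b, d, c) := q in
  setX (setX (setX (setX
    (ord_itv _ (h + a) (2 * h))
    (ord_itv _ (h + d) (h + a)))
    (ord_itv _ (h - d) (h + d)))
    (ord_itv _ (h - a) (h - d)))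
    (ord_itv _ 0 (h - a)).

Notation o0 := (@Ordinal 5 0 isT).
Notation o1 := (@Ordinal 5 1 isT).
Notation o2 := (@Ordinal 5 2 isT).
Notation o3 := (@Ordinal 5 3 isT).
Notation o4 := (@Ordinal 5 4 isT).

(** Case analysis that yields indices with the canonical bound [isT], so that
    syntactically equal matrix entries are recognised as equal by [lia]. *)
Lemma ord5_ind (P : 'I_5 -> Prop) :
  P o0 -> P o1 -> P o2 -> P o3 -> P o4 -> forall i, P i.
Proof.
by move=> ? ? ? ? ?; case=> [[|[|[|[|[|//]]]]] lt_i];
  rewrite (bool_irrelevance lt_i isT).
Qed.

Lemma rev_ord5 : (rev_ord o0 = o4) * (rev_ord o1 = o3) * (rev_ord o2 = o2)
  * (rev_ord o3 = o1) * (rev_ord o4 = o0).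
Proof. by do !split; exact: val_inj. Qed.

(** Reads the parameters back from the upper triangle; the subtraction is not
    truncated on [S5 h], where these off-diagonal entries are at least [h]. *)
Definition coordinates (p : 'M[entry]_5) : offsets * diagonal :=
  let off i j : offset := inord (p i j - h) in
  (off o0 o1, off o0 o2, off o1 o2, off o0 o3,
   (p o0 o0, p o1 o1, p o2 o2, p o3 o3, p o4 o4)).

Lemma arrayK : cancel array coordinates.
Proof.
have offK (k : offset) : inord (up k - h) = k.
  by apply: val_inj; rewrite upE addKn inord_val.
case=> [[[[a b] d] c] [[[[x0 x1] x2] x3] x4]].
by rewrite /coordinates /array !mxE /= !offK.
Qed.

Definition parameters : {set offsets * diagonal} :=
  [set t | offsets_ok t.1 && (t.2 \in diag_box t.1)].

Lemma array_S5 t : t \in parameters -> array t \in S5 h.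
Proof.
case: t => [[[[a b] d] c] [[[[x0 x1] x2] x3] x4]]; rewrite !inE /=.
case/andP=> /and3P[ba db cb].
case/andP=> /andP[] /andP[] /andP[] /andP[? ?] /andP[? ?] /andP[? ?] /andP[? ?] ?.
have := (ltn_ord a, ltn_ord b, ltn_ord d, ltn_ord c).
move=> [[[? ?] ?] ?].
apply/and4P; split.
- do 3![apply/forallP; elim/ord5_ind]; apply/implyP => //= _;
    rewrite !mxE /= ?upE ?downE /=; lia.
- do 3![apply/forallP; elim/ord5_ind]; apply/implyP => //= _;
    rewrite !mxE /= ?upE ?downE /=; lia.
- do 2![apply/forallP; elim/ord5_ind]; apply/implyP => //= _;
    rewrite !rev_ord5 !mxE /= ?upE ?downE /=; lia.
by do 2![apply/forallP; elim/ord5_ind]; rewrite !mxE.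
Qed.

(** Each of [a], [b], [d], [c] is nonnegative because a chain of decreasing
    steps leads from the corresponding entry to the antidiagonal, where the
    complementation rule forces the value [h]; the off-diagonal entries below the
    antidiagonal are then given by the same rule. *)
Lemma S5_array (p : 'M[entry]_5) : p \in S5 h ->
  coordinates p \in parameters /\ array (coordinates p) = p.
Proof.
rewrite inE => /and4P[/forallP col /forallP row /forallP comp /forallP sym].
have {}col (i i' j : 'I_5) : i' = i.+1 :> nat -> (p i' j <= p i j)%N.
  by move=> /eqP; apply/implyP; move: (col i) => /forallP/(_ i')/forallP/(_ j).
have {}row (i j j' : 'I_5) : j' = j.+1 :> nat -> (p i j' <= p i j)%N.
  by move=> /eqP; apply/implyP; move: (row i) => /forallP/(_ j)/forallP/(_ j').
have {}comp (i j : 'I_5) : i != j -> (p i j + p (rev_ord j) (rev_ord i))%N = (2 * h)%N.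
  by move=> ij; apply/eqP; move: ij; apply/implyP; move: (comp i) => /forallP/(_ j).
have {}sym (i j : 'I_5) : p i j = p j i.
  by apply/eqP; move: (sym i) => /forallP/(_ j).
(* The two antidiagonal positions are fixed by the complementation. *)
have mid1 := comp o0 o4 isT; have mid2 := comp o1 o3 isT.
have c01 := comp o0 o1 isT; have c02 := comp o0 o2 isT.
have c03 := comp o0 o3 isT; have c12 := comp o1 o2 isT.
rewrite !rev_ord5 in mid1 mid2 c01 c02 c03 c12.
have le00 := row o0 o0 o1 erefl; have le01 := row o0 o1 o2 erefl.
have le02 := row o0 o2 o3 erefl; have le03 := row o0 o3 o4 erefl.
have le11 := row o1 o1 o2 erefl; have le12 := row o1 o2 o3 erefl.
have le22 := row o2 o2 o3 erefl; have le33 := row o3 o3 o4 erefl.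
have ge11 := col o0 o1 o1 erefl; have ge12 := col o0 o1 o2 erefl.
have ge22 := col o1 o2 o2 erefl; have ge33 := col o2 o3 o3 erefl.
have ge44 := col o3 o4 o4 erefl.
have b00 := ltn_ord (p o0 o0); have b01 := ltn_ord (p o0 o1).
have offK i j : (p i j <= 2 * h)%N -> (inord (p i j - h) : offset) = (p i j - h)%N :> nat.
  by move=> ?; rewrite inordK //; lia.
have k01 := offK o0 o1 ltac:(lia); have k02 := offK o0 o2 ltac:(lia).
have k03 := offK o0 o3 ltac:(lia); have k12 := offK o1 o2 ltac:(lia).
split; first by rewrite !inE /=; lia.
have symE := (sym o1 o0, sym o2 o0, sym o3 o0, sym o4 o0, sym o2 o1,
  sym o3 o1, sym o4 o1, sym o3 o2, sym o4 o2, sym o4 o3).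
apply/matrixP; elim/ord5_ind; elim/ord5_ind; rewrite mxE //= ?symE;
  apply: val_inj; rewrite /= ?upE ?downE /=; lia.
Qed.

Lemma S5_imset : S5 h = array @: parameters.
Proof.
apply/setP=> p; apply/idP/imsetP => [/S5_array[q_ok pE]|[t t_ok ->]].
  by exists (coordinates p).
exact: array_S5.
Qed.

(** The sum over [c] is constant and contributes the factor [b + 1]; each of the
    squares comes from two diagonal entries with equally long intervals. *)
Lemma card_S5 :
  #|S5 h| = (\sum_(a < h.+1) (h.+1 - a) ^ 2 *
    \sum_(b < a.+1) b.+1 *
      \sum_(d < b.+1) (a.+1 - d) ^ 2 * (2 * d).+1)%N.
Proof.
rewrite S5_imset card_imset; last exact: can_inj arrayK.
rewrite /parameters card_dep_set.
pose F (a b d : nat) := ((h.+1 - a) ^ 2 * ((a.+1 - d) ^ 2 * (2 * d).+1))%N.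
transitivity (\sum_(a : offset) \sum_(b : offset | b <= a)
    \sum_(d : offset | d <= b) \sum_(c : offset | c <= b) F a b d)%N.
  rewrite !pair_big_dep /=; apply: eq_big => [[[[a b] d] c]|[[[a b] d] c]] /=.
    by rewrite andbA.
  case/and3P => ba db cb; have lt_a := ltn_ord a.
  rewrite !cardsX !card_ord_itv; try by lia.
  have -> : ((2 * h).+1 - (h + a) = h.+1 - a)%N by lia.
  have -> : ((h + a).+1 - (h + d) = a.+1 - d)%N by lia.
  have -> : ((h + d).+1 - (h - d) = (2 * d).+1)%N by lia.
  have -> : ((h - d).+1 - (h - a) = a.+1 - d)%N by lia.
  have -> : ((h - a).+1 - 0 = h.+1 - a)%N by lia.
  by rewrite /F; ring.
apply: eq_bigr => a _; rewrite big_distrr /=.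
rewrite [RHS](big_ord_widen h.+1 (fun b => (h.+1 - a) ^ 2 * (b.+1 *
      \sum_(d < b.+1) (a.+1 - d) ^ 2 * (2 * d).+1)))%N; last exact: ltn_ord.
apply: eq_bigr => b ba.
rewrite (big_ord_widen h.+1 (fun d => (a.+1 - d) ^ 2 * (2 * d).+1))%N; last exact: ltn_ord.
rewrite !big_distrr /=; apply: eq_bigr => d _.
rewrite sum_nat_const; have -> : #|[pred c : offset | (c <= b)%N]| = b.+1.
  rewrite -[b.+1]subn0 -(@card_ord_itv h.+1 0 b) ?ltn_ord //.
  by apply: eq_card => c; rewrite !inE.
by rewrite /F; ring.
Qed.

End Parametrisation.

(** * Closed form of the triple sum *)

Lemma sum_antidifference (V : zmodType) (F f : nat -> V) (n : nat) :
  F 0%N = 0 -> (forall k, F k.+1 = F k + f k) -> \sum_(k < n) f k = F n.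
Proof.
move=> F0 Fstep; elim: n => [|n IHn]; first by rewrite big_ord0 F0.
by rewrite big_ord_recr /= IHn Fstep.
Qed.

(** The three functions below are the indefinite sums in [d < x], [b < x] and
    [a < x].  The upper end of an outer range occurs inside the summand, through
    [t = a + 1] or [s = h + 1]; keeping it as a separate variable makes each sum
    indefinite in [x] alone, and expanding the square in [t] or [s] gives the
    three terms of each formula. *)
Definition sum_d (t x : rat) : rat :=
  t ^+ 2 * x ^+ 2 - t * (x * (x - 1) * (4 * x + 1)) / 3
  + x * (x - 1) * (3 * x ^+ 2 - x - 1) / 6.

Definition sum_b (t x : rat) : rat :=
  t ^+ 2 * (x ^+ 2 * (x + 1) ^+ 2) / 4
  - t * ((x - 1) * x * (x + 1) * (16 * x ^+ 2 + 25 * x + 6)) / 60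
  + (x - 1) * x * (x + 1) * (10 * x ^+ 3 + 14 * x ^+ 2 - 5 * x - 6) / 120.

Definition sum_a (s x : rat) : rat :=
  s ^+ 2 * (x * (x + 1) * (x + 2)
    * (8 * x ^+ 4 + 32 * x ^+ 3 + 49 * x ^+ 2 + 34 * x + 17)) / 840
  - s * ((x - 1) * x * (x + 1) * (x + 2)
    * (14 * x ^+ 4 + 60 * x ^+ 3 + 97 * x ^+ 2 + 69 * x + 30)) / 840
  + (x - 1) * x * (x + 1) * (x + 2)
    * (112 * x ^+ 5 + 406 * x ^+ 4 + 386 * x ^+ 3 - 205 * x ^+ 2
       - 387 * x - 234) / 15120.

Lemma sum_dE (t : rat) n :
  \sum_(d < n) (t - d%:R) ^+ 2 * (2 * d%:R + 1) = sum_d t n%:R.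
Proof.
apply: (sum_antidifference (F := fun n => sum_d t n%:R)
  (f := fun d => (t - d%:R) ^+ 2 * (2 * d%:R + 1))) => [|k];
  by rewrite /sum_d; field.
Qed.

Lemma sum_bE (t : rat) n :
  \sum_(b < n) b.+1%:R * sum_d t b.+1%:R = sum_b t n%:R.
Proof.
apply: (sum_antidifference (F := fun n => sum_b t n%:R)
  (f := fun b => b.+1%:R * sum_d t b.+1%:R)) => [|k];
  by rewrite /sum_d /sum_b; field.
Qed.

(** In the outer summand the range [b <= a] is complete, so both arguments of
    [sum_b] equal [a + 1]. *)
Lemma sum_aE (s : rat) n :
  \sum_(a < n) (s - a%:R) ^+ 2 * sum_b a.+1%:R a.+1%:R = sum_a s n%:R.
Proof.
apply: (sum_antidifference (F := fun n => sum_a s n%:R)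
  (f := fun a => (s - a%:R) ^+ 2 * sum_b a.+1%:R a.+1%:R)) => [|k];
  by rewrite /sum_a /sum_b; field.
Qed.

Lemma card_S5_rat h : #|S5 h|%:R = sum_a h.+1%:R h.+1%:R.
Proof.
rewrite card_S5 -sum_aE natr_sum; apply: eq_bigr => a _.
rewrite natrM natrX natrB ?(ltnW (ltn_ord a)) //; congr (_ * _).
rewrite -sum_bE natr_sum; apply: eq_bigr => b _.
rewrite natrM; congr (_ * _).
rewrite -sum_dE natr_sum; apply: eq_bigr => d _.
have le_da : (d <= a.+1)%N by have := ltn_ord d; have := ltn_ord b; lia.
by rewrite natrM natrX natrB // -[(2 * d).+1%:R]natr1 natrM.
Qed.

(** * The counting polynomial *)

Lemma horner_pbinom_shift (a c : rat) k :
  (pbinom ('X + a%:P) k).[c] = (k`!%:R)^-1 * \prod_(i < k) (c + a - i%:R).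
Proof.
rewrite /pbinom hornerZ horner_prod; congr (_ * _).
by apply: eq_bigr => i _; rewrite hornerD hornerN hornerD hornerX !hornerC.
Qed.

Lemma horner_pbinom2 (a c : rat) :
  (pbinom ('X + a%:P) 2).[c] = (c + a) * (c + a - 1) / 2.
Proof.
by rewrite horner_pbinom_shift !big_ord_recl big_ord0 !factS fact0 /= /bump /=; field.
Qed.

Lemma horner_pbinom4 (a c : rat) :
  (pbinom ('X + a%:P) 4).[c]
  = (c + a) * (c + a - 1) * (c + a - 2) * (c + a - 3) / 24.
Proof.
by rewrite horner_pbinom_shift !big_ord_recl big_ord0 !factS fact0 /= /bump /=; field.
Qed.

Theorem proposition9p1 :
  (exists! S : {poly rat}, counts_S5 S) /\
  (forall S : {poly rat}, counts_S5 S ->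
     S \Po ('X - (5 / 2)%:P) =
       'X * pbinom ('X + (3 / 2)%:P) 4
          * (2520^-1 *: (16 *: 'X^4 + 64 *: 'X^2 - 17%:P)) /\
     S \Po ('X - (5 / 2)%:P) =
       'X * pbinom ('X + (3 / 2)%:P) 4 * pbinom ('X + (1 / 2)%:P) 2
          * (315^-1 *: (4 *: 'X^2 + 17%:P))).
Proof.
set P1 := _ * (2520^-1 *: _); set P2 := _ * (315^-1 *: _).
have P1E c : P1.[c] = c
    * ((c + 3 / 2) * (c + 3 / 2 - 1) * (c + 3 / 2 - 2) * (c + 3 / 2 - 3) / 24)
    * (2520^-1 * (16 * c ^+ 4 + 64 * c ^+ 2 - 17)).
  rewrite /P1 !hornerM hornerX horner_pbinom4 hornerZ.
  by rewrite hornerD hornerN hornerC hornerD !hornerZ !hornerXn.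
have P2E c : P2.[c] = c
    * ((c + 3 / 2) * (c + 3 / 2 - 1) * (c + 3 / 2 - 2) * (c + 3 / 2 - 3) / 24)
    * ((c + 1 / 2) * (c + 1 / 2 - 1) / 2) * (315^-1 * (4 * c ^+ 2 + 17)).
  rewrite /P2 !hornerM hornerX horner_pbinom4 horner_pbinom2 hornerZ.
  by rewrite hornerD hornerC hornerZ hornerXn.
(* The two forms agree since (4c^2 - 1)(4c^2 + 17) = 16c^4 + 64c^2 - 17. *)
have P12 : P1 = P2 by apply: poly_eq_nat => n; rewrite P1E P2E; field.
pose S0 := P1 \Po ('X + (5 / 2)%:P).
have S0_counts : counts_S5 S0.
  move=> h; rewrite card_S5_rat horner_comp hornerD hornerX hornerC P1E /sum_a.
  by field.
have S0_unique S : counts_S5 S -> S0 = S.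
  by move=> S_counts; apply: poly_eq_nat => h; rewrite S0_counts S_counts.
split; first by exists S0.
move=> S /S0_unique <-; rewrite -P12 /S0 -comp_polyA.
by rewrite comp_polyD comp_polyX comp_polyC subrK comp_polyXr.
Qed.
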